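(* Let $\underline{x}<\overline{x}$ be real numbers and let $\phi:[\underline{x},\overline{x}]\to\mathbb{R}$ be a continuously differentiable function whose derivative $\phi'$ is either convex or concave on $[\underline{x},\overline{x}]$. Suppose that $m\in(\underline{x},\overline{x})$ and $\sigma^2\in(0,(\overline{x}-m)(m-\underline{x}))$. Then, for a random variable $X$ with distribution $\mathbb{P}\in\mathcal{P}(m,\sigma,\underline{x},\overline{x})$, the tight upper bound $\max_{\mathbb{P}\in\mathcal{P}(m,\sigma,\underline{x},\overline{x})}\mathbb{E}_{\mathbb{P}}[\phi(X)]$ is attained by a discrete distribution with two support points.
   Context: $\mathcal{P}(m,\sigma,\underline{x},\overline{x})$ is the set of all probability distributions $\mathbb{P}$ supported in $[\underline{x},\overline{x}]$ with $\mathbb{E}_{\mathbb{P}}[X]=m$ and $\mathbb{E}_{\mathbb{P}}[X^2]=\sigma^2+m^2$. ''Attained'' means that some two-point distribution in this set maximizes $\mathbb{E}_{\mathbb{P}}[\phi(X)]$ over the set. *)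

(* Defs.v *)
From HB Require Import structures.
From mathcomp Require Import all_boot all_order all_algebra.
From mathcomp Require Import all_classical all_reals all_analysis.

Set Implicit Arguments.
Unset Strict Implicit.
Unset Printing Implicit Defensive.

Import Order.TTheory GRing.Theory Num.Theory.
Import numFieldNormedType.Exports.

Local Open Scope classical_set_scope.
Local Open Scope ring_scope.

(* The difference quotients are taken within `D`, so that at an endpoint of an
   interval the derivative is one-sided and the values of `f` outside `D` play
   no role. *)
Definition continuously_differentiable_on (R : realType) (D : set R)
    (f df : R -> R) : Prop :=
  (forall x, D x ->
     (f y - f x) / (y - x) @[y --> within D x^'] --> df x) /\
  {within D, continuous df}.

Definition concave_function (R : realType) (D : set R^o) (f : R^o -> R^o) :
    Prop :=
  convex_function D (fun x => - f x).

(* Support in the closed interval [xl, xu] is expressed by its having full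
   mass. *)
Definition distributions (R : realType) (m sigma xl xu : R) :
    set (probability R R) :=
  [set P : probability R R |
    [/\ P `[xl, xu]%classic = 1%E,
       'E_P[fun x => x]%E = m%:E &
       'E_P[fun x => (x ^+ 2)%R]%E = (sigma ^+ 2 + m ^+ 2)%:E]].

(* Both weights are required to be positive and the points distinct, so that
   the support has exactly two elements. *)
Definition two_point_distribution (R : realType)
    (P : probability R R) : Prop :=
  exists a b p : R, [/\ a != b, 0 < p, p < 1 &
    forall A : set R, measurable A ->
      P A = (p%:E * \d_a A + (1 - p)%:E * \d_b A)%E].

(* Main.v *)
(* Weak duality: if a quadratic [q] dominates [phi] on [[xl, xu]], then
   [E phi <= E q], and [E q] depends only on the first two moments; equality
   holds for a two-point distribution carried by the contact points of [q] and
   [phi].  When [phi'] is convex the contact points are [xu] and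
   [a = m - sigma^2 / (xu - m)], where [q] interpolates [phi] at [xu] and is
   tangent to it at [a]: [(q - phi)'] is then concave and vanishes at [a],
   which forces [q - phi >= 0].  The concave case is its mirror image, with
   contact points [xl] and [m + sigma^2 / (m - xl)]. *)
Require Import Defs.
From HB Require Import structures.
From mathcomp Require Import all_boot all_order all_algebra.
From mathcomp Require Import all_classical all_reals all_analysis.
From mathcomp Require Import measurable_realfun ring lra.

Set Implicit Arguments.
Unset Strict Implicit.
Unset Printing Implicit Defensive.

Import Order.TTheory GRing.Theory Num.Theory.
Import numFieldNormedType.Exports.

Local Open Scope classical_set_scope.
Local Open Scope ring_scope.

(** The weight of [x] in the convex combination giving [y] is [(z - y) / (z - x)]. Clearing the
    denominator leaves an inequality linear in the values of [f], to which affine functions can be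
    added freely. *)
Lemma convex_function_chord (R : realType) (a b : R) (f : R -> R) (x y z : R) :
  convex_function (`[a, b] : set R^o) f ->
  a <= x -> x < y -> y < z -> z <= b ->
  (z - x) * f y <= (z - y) * f x + (y - x) * f z.
Proof.
move=> cf ax xy yz zb.
have zx0 : 0 < z - x by lra.
have t01 : 0 <= (z - y) / (z - x) <= 1.
  apply/andP; split; first by apply: divr_ge0; lra.
  by rewrite ler_pdivrMr//; lra.
have /andP[t0 t1] := t01.
have := cf (Itv01 t0 t1) x z.
rewrite !inE/= !in_itv/=.
move=> /(_ ltac:(lra) ltac:(lra)).
rewrite [X in f X](_ : _ = y); last first.
  transitivity ((z - y) / (z - x) * x + (1 - (z - y) / (z - x)) * z) => //.
  by field; lra.
rewrite convRE /= /unstable.onem.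
rewrite -(ler_pM2l zx0) => /le_trans; apply.
rewrite le_eqVlt; apply/orP; left; apply/eqP; field; lra.
Qed.

(** * Nonnegativity from zeros and the shape of the derivative *)

Section touching.
Variable R : realType.
Implicit Types (a b t : R) (g dg : R -> R).

(* If [g x < 0], the mean value theorem between [x], [t] and [b] gives values
   of [dg] whose signs contradict concavity and [dg t = 0]. *)
Lemma concave_derivative_ge0 a b t g dg :
  (forall x y, a <= x -> x < y -> y <= b ->
     exists2 c, x < c < y & g y - g x = dg c * (y - x)) ->
  (forall x y z, a <= x -> x < y -> y < z -> z <= b ->
     (z - y) * dg x + (y - x) * dg z <= (z - x) * dg y) ->
  a < t < b -> g t = 0 -> dg t = 0 -> g b = 0 ->
  forall x, a <= x <= b -> 0 <= g x.
Proof.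
move=> mvt ccv /andP[at_ tb] gt dgt gb x /andP[ax xb].
rewrite leNgt; apply/negP => gx.
have [xt|tx|xt] := ltgtP x t; last by move: gx; rewrite xt gt ltxx.
- have [c /andP[xc ct] Ec] := mvt x t ax xt (ltW tb).
  have [c' /andP[tc' c'b] Ec'] := mvt t b (ltW at_) tb (lexx _).
  have dc : 0 < dg c by rewrite -(@pmulr_lgt0 _ (t - x)); lra.
  have dc' : dg c' = 0.
    move: Ec'; rewrite gb gt subrr => /esym/eqP.
    by rewrite mulf_eq0 => /orP[/eqP//|/eqP]; lra.
  have := ccv c t c' ltac:(lra) ct tc' (ltW c'b).
  rewrite dgt dc' !mulr0.
  have : 0 < (c' - t) * dg c by rewrite mulr_gt0//; lra.
  by lra.
- have {}xb : x < b.
    by rewrite lt_neqAle xb andbT; apply: contraTneq gx => ->; rewrite gb ltxx.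
  have [c /andP[tc cx] Ec] := mvt t x (ltW at_) tx (ltW xb).
  have [c' /andP[xc' c'b] Ec'] := mvt x b ax xb (lexx _).
  have dc : dg c < 0 by rewrite -(@pmulr_llt0 _ (x - t)); lra.
  have dc' : 0 < dg c' by rewrite -(@pmulr_lgt0 _ (b - x)); lra.
  have := ccv t c c' (ltW at_) tc ltac:(lra) (ltW c'b).
  rewrite dgt mulr0.
  have : (c' - t) * dg c < 0 by rewrite pmulr_rlt0//; lra.
  have : 0 < (c - t) * dg c' by rewrite mulr_gt0//; lra.
  by lra.
Qed.

(** The reflection of [x] to [- x] exchanges the endpoints and turns the derivative into
    [- dg (- x)], which is concave when [dg] is convex. *)
Lemma convex_derivative_ge0 a b t g dg :
  (forall x y, a <= x -> x < y -> y <= b ->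
     exists2 c, x < c < y & g y - g x = dg c * (y - x)) ->
  (forall x y z, a <= x -> x < y -> y < z -> z <= b ->
     (z - x) * dg y <= (z - y) * dg x + (y - x) * dg z) ->
  a < t < b -> g t = 0 -> dg t = 0 -> g a = 0 ->
  forall x, a <= x <= b -> 0 <= g x.
Proof.
move=> mvt cvx /andP[at_ tb] gt dgt ga x /andP[ax xb].
rewrite -(opprK x).
apply: (@concave_derivative_ge0 (- b) (- a) (- t)
  (fun x => g (- x)) (fun x => - dg (- x))); rewrite ?opprK ?dgt ?oppr0//.
- move=> u v bu uv va.
  have [c /andP[vc cu] Ec] := mvt (- v) (- u) ltac:(lra) ltac:(lra) ltac:(lra).
  exists (- c); first lra.
  by rewrite opprK; lra.
- move=> u v w bu uv vw wa.
  have := cvx (- w) (- v) (- u) ltac:(lra) ltac:(lra) ltac:(lra) ltac:(lra).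
  by lra.
- by lra.
- by lra.
Qed.

End touching.

(** * Calculus on the closed interval and the majorizing parabola *)

Section continuously_differentiable.
Variables (R : realType) (a b : R) (f df : R -> R).
Hypothesis f_C1 : continuously_differentiable_on `[a, b] f df.

(** Near an interior point every [y] lies in the interval, so the limit within the interval is the
    full limit; the substitution [y = h + x] gives the usual quotient in [h]. *)
Lemma continuously_differentiable_is_derive x :
  x \in `]a, b[ -> is_derive x 1 f (df x).
Proof.
rewrite in_itv/= => /andP[ax xb].
suff H : (h^-1 *: ((f \o shift x) (h *: (1 : R)) - f x)) @[h --> 0^'] --> df x.
  by apply: DeriveDef; [apply/cvg_ex; exists (df x)|apply/cvg_lim].
have [/(_ x)] := f_C1; rewrite /= in_itv/= (ltW ax) (ltW xb) => /(_ isT) + _.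
move=> /cvgrPdist_lt H; apply/cvgrPdist_lt => e /H.
rewrite near_withinE /dnbhs !near_withinE => {}H.
have {}H : \forall y \near x, y != x -> y \in `[a, b] ->
    `|df x - (f y - f x) / (y - x)| < e := H.
have ab_x : \forall y \near x, y \in `]a, b[.
  by apply: near_in_itvoo; rewrite in_itv/= ax.
rewrite (near_shift 0 x) in H; rewrite (near_shift 0 x) in ab_x.
apply: filterS2 H ab_x => h /=; rewrite subr0 => Hh hab h0.
rewrite [h *: 1]mulr1 [_ *: _]mulrC -[X in _ / X](addrK x h).
apply: Hh; first by rewrite -subr_eq0 addrK.
exact: subset_itv_oo_cc hab.
Qed.

(** Off [x], [f y] is the difference quotient times [y - x], plus [f x], and this tends to
    [df x * 0 + f x]. The punctured limit omits [y = x], where the estimate is trivial. *)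
Lemma continuously_differentiable_continuous : {within `[a, b], continuous f}.
Proof.
apply/subspace_continuousP => x abx.
have [/(_ x abx) df_x _] := f_C1.
have : (f y - f x) / (y - x) * (y - x) + f x @[y --> within `[a, b] x^']
    --> f x.
  rewrite -[X in _ --> X]add0r -[X in _ --> X + _](mulr0 (df x)).
  apply: cvgD; last exact: cvg_cst.
  apply: cvgM => //.
  rewrite -[X in _ --> X](subrr x).
  apply: cvgB; last exact: cvg_cst.
  apply: cvg_within_filter.
  exact: (cvg_trans (@nbhs_dnbhs _ x)).
move=> /cvgrPdist_lt H; apply/cvgrPdist_lt => e e0.
move: (H e e0).
rewrite /dnbhs !near_withinE.
apply: filterS => y.
have [-> _ _|yx] := eqVneq y x; first by rewrite subrr normr0.
move=> /(_ isT) + aby => /(_ aby).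
by rewrite divfK ?subr_eq0// subrK.
Qed.

Lemma continuously_differentiable_quadratic_MVT (c0 c1 c2 : R) x y :
  a <= x -> x < y -> y <= b ->
  let g x := c0 + c1 * x + c2 * x ^+ 2 - f x in
  let dg x := c1 + 2 * c2 * x - df x in
  exists2 c, x < c < y & g y - g x = dg c * (y - x).
Proof.
move=> ax xy yb g dg.
pose q (x : R) := c0 + c1 * x + c2 * x ^+ 2.
have [c + Ec] : exists2 c, c \in `]x, y[ & g y - g x = dg c * (y - x).
  apply: MVT => //.
  - move=> z; rewrite in_itv/= => /andP[xz zy].
    have fz : is_derive z 1 f (df z).
      by apply: continuously_differentiable_is_derive; rewrite in_itv/=; lra.
    apply: is_derive_eq.
    by rewrite /dg /GRing.scale /=; ring.
  - apply: (@continuous_subspaceW _ _ _ `[a, b]).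
      by move=> z /=; rewrite !in_itv/=; lra.
    apply: (@within_continuousB _ _ _ _ q); last first.
      exact: continuously_differentiable_continuous.
    apply: continuous_subspaceT => z.
    apply: differentiable_continuous; apply/derivable1_diffP.
    exact: ex_derive.
by rewrite in_itv/=; exists c.
Qed.

Lemma tangent_parabola_majorant (t e : R) :
  a < t < b ->
  (convex_function (`[a, b] : set R^o) df /\ e = b) \/
  (concave_function `[a, b] df /\ e = a) ->
  exists c0 c1 c2 : R,
    [/\ forall x, x \in `[a, b] -> f x <= c0 + c1 * x + c2 * x ^+ 2,
        f t = c0 + c1 * t + c2 * t ^+ 2 &
        f e = c0 + c1 * e + c2 * e ^+ 2].
Proof.
move=> /andP[at_ tb] df_shape.
have et : e - t != 0 by rewrite subr_eq0; case: df_shape => -[_ ->]; lra.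
(* The parabola is [f t + df t * (x - t) + k * (x - t) ^+ 2], with [k] chosen so that it passes
   through [f e] at [e]; the witnesses are its coefficients in powers of [x]. *)
pose k := (f e - f t - df t * (e - t)) / (e - t) ^+ 2.
exists (f t - df t * t + k * t ^+ 2), (df t - 2 * k * t), k.
set c0 := (X in X + _ * _ + _); set c1 := (X in _ + X * _ + _).
have ft : f t = c0 + c1 * t + k * t ^+ 2 by rewrite /c0 /c1; ring.
have fe : f e = c0 + c1 * e + k * e ^+ 2 by rewrite /c0 /c1 /k; field.
pose g x := c0 + c1 * x + k * x ^+ 2 - f x.
pose dg x := c1 + 2 * k * x - df x.
have mvt : forall x y, a <= x -> x < y -> y <= b ->
    exists2 c, x < c < y & g y - g x = dg c * (y - x).
  exact: continuously_differentiable_quadratic_MVT.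
have gt : g t = 0 by rewrite /g ft subrr.
have ge : g e = 0 by rewrite /g fe subrr.
have dgt : dg t = 0 by rewrite /dg /c1; ring.
suff g_ge0 : forall x, a <= x <= b -> 0 <= g x.
  by split=> // x; rewrite in_itv/= => /g_ge0; rewrite subr_ge0.
case: df_shape => -[shape ee].
(* The affine part of [dg] satisfies the chord relation with equality, so only the chord inequality
   of [df] matters. *)
- apply: (@concave_derivative_ge0 _ a b t g dg) => //;
    rewrite ?at_ ?tb// -?ee//.
  move=> x y z ax xy yz; rewrite ee => zb.
  by have := convex_function_chord shape ax xy yz zb; rewrite /dg; lra.
- apply: (@convex_derivative_ge0 _ a b t g dg) => //; rewrite ?at_ ?tb// -?ee//.
  move=> x y z; rewrite ee => ax xy yz zb.
  by have := convex_function_chord shape ax xy yz zb; rewrite /dg; lra.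
Qed.

End continuously_differentiable.

(** * Two-point probability measures *)

Section two_point.
Context (R : realType) (p : {i01 R}) (a b : R).

Definition two_point_prob : set R -> \bar R :=
  measure_add (mscale p%:num%:nng \d_a) (mscale (1 - p%:num)%:nng \d_b).

HB.instance Definition _ := Measure.on two_point_prob.

Lemma two_point_probE (A : set R) :
  two_point_prob A = (p%:num%:E * \d_a A + (1 - p%:num)%:E * \d_b A)%E.
Proof. by rewrite /two_point_prob measure_addE. Qed.

Let two_point_prob_setT : two_point_prob setT = 1%E.
Proof. by rewrite two_point_probE !diracT !mule1 -EFinD addrC subrK. Qed.

HB.instance Definition _ :=
  Measure_isProbability.Build _ _ _ two_point_prob two_point_prob_setT.

(** Additivity of the integral in the measure is applied to nonnegative functions only, so [f] is
    split into positive and negative parts, recombined at [a] and [b]. *)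
Lemma expectation_two_point (f : R -> R) : measurable_fun setT f ->
  'E_two_point_prob[f]%E = (p%:num * f a + (1 - p%:num) * f b)%:E.
Proof.
move=> mf.
have ge0 (g : R -> \bar R) : measurable_fun [set: R] g ->
    (forall x, 0 <= g x)%E ->
    (\int[two_point_prob]_x g x = p%:num%:E * g a + (1 - p%:num)%:E * g b)%E.
  move=> mg g0; rewrite ge0_integral_measure_add// !ge0_integral_mscale//=.
  by rewrite !integral_dirac//= !diracT !mul1e.
have /measurable_EFinP mEf := mf.
rewrite unlock integralE !ge0; try by [].
- have fE x : f x = f^\+ x - f^\- x by rewrite -[in LHS](funrposBneg f).
  rewrite !(funerpos f) !(funerneg f) [in RHS](fE a) [in RHS](fE b).
  rewrite /comp -!EFinM -!EFinD.
  by congr EFin => /=; ring.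
- exact: measurable_funeneg.
- exact: measurable_funepos.
Qed.

End two_point.

(** * Consequences of the moment and support constraints *)

Section moments.
Context (R : realType) (m sigma xl xu : R) (Q : probability R R).
Hypothesis Q_dist : distributions m sigma xl xu Q.

Let mid : measurable_fun [set: R] (fun x : R => x).
Proof. exact: measurable_id. Qed.

Let msqr : measurable_fun [set: R] (fun x : R => x ^+ 2).
Proof. exact: measurable_funX. Qed.

Lemma distributions_integrable_sqr :
  Q.-integrable setT (fun x => (x ^+ 2)%:E).
Proof.
have [_ _ + ] := Q_dist; rewrite unlock => EX2.
apply/integrableP; split; first exact/measurable_EFinP.
under eq_integral do rewrite gee0_abs ?lee_fin ?sqr_ge0//.
by rewrite EX2 ltry.
Qed.

(** Domination: [1 + x ^+ 2] is integrable and bounds the absolute value of [x]. *)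
Lemma distributions_integrable_id : Q.-integrable setT (fun x => x%:E).
Proof.
have int1 : Q.-integrable setT (fun x => (1 + x ^+ 2)%:E).
  rewrite (_ : (fun _ => _) = (cst 1%E \+ (fun x => (x ^+ 2)%:E))%E)//.
  apply: integrableD => //; last exact: distributions_integrable_sqr.
  exact: finite_measure_integrable_cst.
apply: le_integrable int1 => //; first exact/measurable_EFinP.
move=> x _; rewrite !abse_EFin lee_fin [leRHS]ger0_norm; last by nra.
by rewrite ler_norml; apply/andP; split; nra.
Qed.

Lemma distributions_integrable_quadratic (c0 c1 c2 : R) :
  Q.-integrable setT (fun x => (c0 + c1 * x + c2 * x ^+ 2)%:E).
Proof.
have := distributions_integrable_sqr; have := distributions_integrable_id.
move=> i1 i2.
rewrite (_ : (fun _ => _) = ((cst c0%:E \+ (fun x => c1%:E * x%:E))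
   \+ (fun x => c2%:E * (x ^+ 2)%:E))%E); last by apply/funext => x.
apply: integrableD => //; last exact: integrableZl.
apply: integrableD => //; last exact: integrableZl.
exact: finite_measure_integrable_cst.
Qed.

Lemma distributions_expectation_quadratic (c0 c1 c2 : R) :
  'E_Q[fun x => (c0 + c1 * x + c2 * x ^+ 2)%R]%E =
  (c0 + c1 * m + c2 * (sigma ^+ 2 + m ^+ 2))%:E.
Proof.
have := distributions_integrable_sqr; have := distributions_integrable_id.
move=> i1 i2; have [_ + +] := Q_dist; rewrite unlock => EX EX2.
under eq_integral do rewrite 2!EFinD 2!EFinM.
rewrite !integralD//=; last 4 first.
- exact: finite_measure_integrable_cst.
- exact: integrableZl.
- apply: integrableD => //; last exact: integrableZl.
  exact: finite_measure_integrable_cst.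
- exact: integrableZl.
rewrite !integralZl//= EX EX2 integral_cst//= probability_setT mule1.
by rewrite -!EFinM -!EFinD.
Qed.

(** The complement of the interval is [Q]-null, so both integrals reduce to the interval, where the
    pointwise bound holds. *)
Lemma distributions_le_expectation (f g : R -> R) :
  Q.-integrable setT (EFin \o f) -> Q.-integrable setT (EFin \o g) ->
  (forall x, x \in `[xl, xu] -> f x <= g x) ->
  ('E_Q[f] <= 'E_Q[g])%E.
Proof.
move=> intf intg fg; have [Q1 _ _] := Q_dist.
have QC : Q (~` `[xl, xu]) = 0%E.
  by rewrite probability_setC// Q1 subee.
have mC : measurable (~` `[xl, xu] : set R) by exact: measurableC.
rewrite unlock (negligible_integral mC _ intf QC)//.
rewrite (negligible_integral mC _ intg QC)// setTD setCK.
apply: le_integral => //.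
- exact: integrableS intf.
- exact: integrableS intg.
- by move=> x; rewrite inE/= => xD; rewrite lee_fin fg.
Qed.

End moments.

(** The extension by zero is measurable, and bounded because the image of a compact interval is
    compact; a bounded measurable function is integrable for a probability. *)
Lemma restrict_continuous_integrable (R : realType) (a b : R) (f : R -> R)
    (Q : probability R R) :
  {within `[a, b], continuous f} ->
  Q.-integrable setT (EFin \o (f \_ `[a, b])).
Proof.
move=> cf.
apply: measurable_bounded_integrable => //.
- by rewrite [ltLHS]probability_setT ltry.
- apply/measurable_restrict => //; rewrite setTI.
  exact: subspace_continuous_measurable_fun.
- have := compact_bounded (continuous_compact cf (@segment_compact _ a b)).
  move=> [M [Mreal HM]]; exists `|M|; split=> // N MN x _ /=.
  have N0 : 0 <= N by rewrite (le_trans _ (ltW MN)).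
  rewrite patchE; case: ifPn => [|_]; last by rewrite normr0.
  rewrite inE => abx; apply: HM; last by exists x.
  by rewrite (le_lt_trans _ MN)// ler_norm.
Qed.

Lemma two_point_optimal (R : realType) (xl xu : R) (phi : R -> R)
    (m sigma a b c0 c1 c2 : R) :
  {within `[xl, xu], continuous phi} ->
  xl <= a -> a < m -> m < b -> b <= xu ->
  (b - m) * (m - a) = sigma ^+ 2 ->
  (forall x, x \in `[xl, xu] -> phi x <= c0 + c1 * x + c2 * x ^+ 2) ->
  phi a = c0 + c1 * a + c2 * a ^+ 2 ->
  phi b = c0 + c1 * b + c2 * b ^+ 2 ->
  exists P : probability R R,
    [/\ distributions m sigma xl xu P,
        two_point_distribution P &
        forall Q : probability R R,
          distributions m sigma xl xu Q ->
          ('E_Q[phi \_ `[xl, xu]] <= 'E_P[phi \_ `[xl, xu]])%E].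
Proof.
move=> cphi xla am mb bxu sigmaE phi_le phia phib.
have ab0 : 0 < b - a by lra.
(* This weight at [a] is forced by the mean [m]; the variance is then [(b - m) * (m - a)]. *)
have p0 : 0 < (b - m) / (b - a) by rewrite divr_gt0//; lra.
have p1 : (b - m) / (b - a) < 1 by rewrite ltr_pdivrMr//; lra.
pose p := Itv01 (ltW p0) (ltW p1).
have aD : a \in `[xl, xu] by rewrite in_itv/=; lra.
have bD : b \in `[xl, xu] by rewrite in_itv/=; lra.
exists (two_point_prob p a b : probability R R).
have P_dist : distributions m sigma xl xu (two_point_prob p a b).
  split.
  - rewrite [LHS]two_point_probE !diracE !mem_set//=.
    by rewrite !mule1 -EFinD addrC subrK.
  - rewrite expectation_two_point//=; congr EFin; field; lra.
  - rewrite expectation_two_point//=.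
    by congr EFin; rewrite -sigmaE; field; lra.
split=> //.
  exists a, b, ((b - m) / (b - a)); split=> //.
    by rewrite lt_eqF//; lra.
  by move=> A _; rewrite [LHS]two_point_probE.
move=> Q Q_dist.
have mphi := restrict_continuous_integrable Q cphi.
(* The quadratic has the same expectation under [Q] and under the two-point measure, and agrees with
   [phi] at [a] and [b]. *)
apply: (@le_trans _ _ 'E_Q[fun x => (c0 + c1 * x + c2 * x ^+ 2)%R]%E).
  apply: (distributions_le_expectation Q_dist) => //.
    exact: (distributions_integrable_quadratic Q_dist).
  by move=> x xD; rewrite patchE mem_set// phi_le.
rewrite (distributions_expectation_quadratic Q_dist).
rewrite -(distributions_expectation_quadratic P_dist).
rewrite !expectation_two_point//.
- by rewrite !patchE !mem_set// phia phib.
- by have /measurable_int/measurable_EFinP := mphi.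
- apply/measurable_EFinP.
  by have /measurable_int := distributions_integrable_quadratic P_dist c0 c1 c2.
Qed.

Theorem proposition1 (R : realType) (xl xu : R) (phi dphi : R -> R)
    (m sigma : R)
    (xl_lt_xu : xl < xu)
    (phi_C1 : continuously_differentiable_on `[xl, xu] phi dphi)
    (dphi_convex_or_concave :
       convex_function (`[xl, xu] : set R^o) dphi \/
       concave_function `[xl, xu] dphi)
    (m_in : xl < m < xu)
    (sigma2_in : 0 < sigma ^+ 2 < (xu - m) * (m - xl)) :
  exists P : probability R R,
    [/\ distributions m sigma xl xu P,
        two_point_distribution P &
        forall Q : probability R R,
          distributions m sigma xl xu Q ->
          ('E_Q[phi \_ `[xl, xu]] <= 'E_P[phi \_ `[xl, xu]])%E].
Proof.
have /andP[lm mu] := m_in; have /andP[s0 s1] := sigma2_in.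
have cphi := continuously_differentiable_continuous phi_C1.
case: dphi_convex_or_concave => shape.
- pose a := m - sigma ^+ 2 / (xu - m).
  have ma : a < m by rewrite /a ltrBlDr ltrDl divr_gt0//; lra.
  (* The strict upper bound on [sigma ^+ 2] places the tangency point in the interior. *)
  have la : xl < a.
    by rewrite /a ltrBrDr -ltrBrDl ltr_pdivrMr; lra.
  have [|c0 [c1 [c2 [H1 H2 H3]]]] :=
    @tangent_parabola_majorant _ _ _ _ _ phi_C1 a xu _
      (or_introl (conj shape erefl)).
    by rewrite la/=; lra.
  apply: (two_point_optimal cphi (ltW la) ma mu (lexx _) _ H1) => //.
  by rewrite /a; field; lra.
(* The solution of [(b - m) * (m - xl) = sigma ^+ 2], the variance condition with the other point at
   [xl]. *)
- pose b := m + sigma ^+ 2 / (m - xl).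
  have mb : m < b by rewrite /b ltrDl divr_gt0//; lra.
  have bu : b < xu.
    by rewrite /b -ltrBrDl ltr_pdivrMr; lra.
  have [|c0 [c1 [c2 [H1 H2 H3]]]] :=
    @tangent_parabola_majorant _ _ _ _ _ phi_C1 b xl _
      (or_intror (conj shape erefl)).
    by rewrite bu andbT; lra.
  apply: (two_point_optimal cphi (lexx _) lm mb (ltW bu) _ H1) => //.
  by rewrite /b; field; lra.
Qed.
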